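(* Let $\mathcal{G}=(V,E)$ be a finite, simple, connected, undirected graph, let $\varepsilon: E\to[0,\infty)$ be a privacy function (with $\varepsilon(u,v)=\varepsilon(v,u)$), let $T:V\to\{1,2\}$ be a binary-valued query, let $S\subseteq V$ contain the boundary set $\partial_T(\mathcal{G})$, and let $p:S\to[0,1]$ be a partial function. There exists an algorithm, running in time polynomial in the size of $\mathcal{G}$, which takes $\mathcal{G}$, $\varepsilon(\cdot)$, $T$ and $p$ as input and behaves as follows. If $p$ has no extension that is binary-valued heterogeneous $\varepsilon(\cdot)$-differentially private, it outputs ''no $\varepsilon(\cdot)$-DP extension of $p$ exists''. Otherwise it outputs an extension $\tilde p:V\to[0,1]$ of $p$ which is binary-valued heterogeneous $\varepsilon(\cdot)$-differentially private and which is the unique optimal such extension with respect to $\leq_T$, i.e. for every binary-valued heterogeneous $\varepsilon(\cdot)$-differentially private extension $q$ of $p$ we have $q\leq_T\tilde p$, and $\tilde p$ is the only such extension with this property.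
   Context: Vertices of $\mathcal{G}$ represent datasets and edges represent neighboring datasets; write $u\sim v$ for $(u,v)\in E$. For $A\subseteq V$, $N(A)$ is the set of vertices in $V\setminus A$ adjacent to some vertex of $A$; $N(u)=N(\{u\})$. The boundary set is $\partial_T(\mathcal{G})=\{u\in V:\exists v\in N(u),\ T(v)\neq T(u)\}$. An extension of $p:S\to[0,1]$ is a function $\tilde p:V\to[0,1]$ with $\tilde p(v)=p(v)$ for all $v\in S$. A function $q:V\to[0,1]$ (interpreted as $q(v)=\Pr[\mathcal{M}(v)=1]$ for a randomized mechanism $\mathcal{M}:V\to\{1,2\}$) is binary-valued heterogeneous $\varepsilon(\cdot)$-differentially private if for every edge $(u,v)\in E$ (in both orders): $q(u)\le e^{\varepsilon(u,v)}q(v)$, $1-q(u)\le e^{\varepsilon(u,v)}(1-q(v))$, $q(v)\le e^{\varepsilon(u,v)}q(u)$, and $1-q(v)\le e^{\varepsilon(u,v)}(1-q(u))$. For $q,q':V\to[0,1]$, write $q\leq_T q'$ if for every $v\in V$: $q(v)\le q'(v)$ when $T(v)=1$, and $1-q(v)\le 1-q'(v)$ when $T(v)=2$. *)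

(* Defs.v *)
From mathcomp Require Import all_boot all_order all_algebra.
From mathcomp Require Import reals sequences exp.

Set Implicit Arguments.
Unset Strict Implicit.
Unset Printing Implicit Defensive.

Import Order.TTheory GRing.Theory Num.Theory.

(** * Graphs, privacy functions, extensions *)

Section Graphs.
Variables (V : finType) (adj : rel V).

Definition simple_graph : Prop := symmetric adj /\ irreflexive adj.

Definition connected_graph : Prop := forall u v : V, connect adj u v.

Definition edges : {set {set V}} :=
  [set A : {set V} | [exists u, exists v, adj u v && (A == [set u; v])]].

Definition neighborhood (A : {set V}) : {set V} :=
  [set v in ~: A | [exists u in A, adj u v]].

(* Queries with values in {1, 2} are represented by functions into nat
   satisfying [binary_query]. *)
Definition binary_query (T : V -> nat) : Prop := forall v, T v \in [:: 1; 2].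

Definition boundary (T : V -> nat) : {set V} :=
  [set u | [exists v in neighborhood [set u], T v != T u]].

End Graphs.

Section Privacy.
Variables (R : realType) (V : finType).
Local Open Scope ring_scope.

(* A function on E is a function on V * V, of which only the values on adjacent
   pairs are meaningful. *)
Definition privacy_function (adj : rel V) (eps : V -> V -> R) : Prop :=
  forall u v, adj u v -> 0 <= eps u v /\ eps u v = eps v u.

Definition unit_valued (S : {set V}) (p : V -> R) : Prop :=
  {in S, forall v, 0 <= p v <= 1}.

(* The partial function p : S -> [0, 1] is given by the restriction to S of a
   function on V. *)
Definition extension (S : {set V}) (p q : V -> R) : Prop :=
  unit_valued [set: V] q /\ {in S, q =1 p}.

Definition hetero_dp (adj : rel V) (eps : V -> V -> R) (q : V -> R) : Prop :=
  forall u v, adj u v ->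
    [/\ q u <= expR (eps u v) * q v,
        1 - q u <= expR (eps u v) * (1 - q v),
        q v <= expR (eps u v) * q u &
        1 - q v <= expR (eps u v) * (1 - q u)].

Definition dp_extension (adj : rel V) (eps : V -> V -> R) (S : {set V})
    (p q : V -> R) : Prop :=
  extension S p q /\ hetero_dp adj eps q.

Definition le_query (T : V -> nat) (q q' : V -> R) : Prop :=
  forall v, (T v = 1%N -> q v <= q' v) /\ (T v = 2%N -> 1 - q v <= 1 - q' v).

Definition optimal_dp_extension (adj : rel V) (eps : V -> V -> R)
    (T : V -> nat) (S : {set V}) (p q : V -> R) : Prop :=
  dp_extension adj eps S p q /\
  forall q', dp_extension adj eps S p q' -> le_query T q' q.

End Privacy.

(** * A real random-access machine

  Programs are finite pieces of syntax that do not mention the field of real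
  numbers: the only constants are natural numbers.  The memory consists of
  arrays of natural numbers and arrays of reals.  Array names are literals, so a
  program uses finitely many arrays; indices are computed.

  Natural numbers support addition and truncated subtraction but no
  multiplication: under unit cost, repeated squaring would produce numbers with
  exponentially many bits in polynomial time.  Reals are exact, with unit-cost
  field operations, exponential and comparison; there is no conversion (such as
  the integer part) from computed reals to natural numbers. *)

Inductive nexpr : Type :=
  | NConst of nat
  | NGet of nat & nexpr
  | NAdd of nexpr & nexpr
  | NSub of nexpr & nexpr.

Inductive rexpr : Type :=
  | RConst of nat
  | RGet of nat & nexpr
  | RAdd of rexpr & rexpr
  | RSub of rexpr & rexpr
  | RMul of rexpr & rexpr
  | RDiv of rexpr & rexpr
  | RExp of rexpr.

Inductive bexpr : Type :=
  | BNle of nexpr & nexpr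
  | BRle of rexpr & rexpr
  | BNot of bexpr
  | BAnd of bexpr & bexpr.

Inductive program : Type :=
  | Skip
  | NSet of nat & nexpr & nexpr
  | RSet of nat & nexpr & rexpr
  | Seq of program & program
  | If of bexpr & program & program
  | While of bexpr & program.

Section Semantics.
Variable R : realType.

Record state : Type := State {
  nmem : nat -> nat -> nat;
  rmem : nat -> nat -> R
}.

Definition upd (X : Type) (m : nat -> nat -> X) (a i : nat) (x : X) :
    nat -> nat -> X :=
  fun b j => if (b == a) && (j == i) then x else m b j.

Fixpoint neval (s : state) (x : nexpr) : nat :=
  match x with
  | NConst k => k
  | NGet a i => nmem s a (neval s i)
  | NAdd x y => neval s x + neval s y
  | NSub x y => neval s x - neval s y
  end.

Fixpoint reval (s : state) (x : rexpr) : R :=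
  match x with
  | RConst k => k%:R%R
  | RGet a i => rmem s a (neval s i)
  | RAdd x y => (reval s x + reval s y)%R
  | RSub x y => (reval s x - reval s y)%R
  | RMul x y => (reval s x * reval s y)%R
  | RDiv x y => (reval s x / reval s y)%R
  | RExp x => expR (reval s x)
  end.

Fixpoint beval (s : state) (b : bexpr) : bool :=
  match b with
  | BNle x y => neval s x <= neval s y
  | BRle x y => (reval s x <= reval s y)%R
  | BNot b => ~~ beval s b
  | BAnd b c => beval s b && beval s c
  end.

(* Evaluating an expression costs its number of nodes. *)
Fixpoint ncost (x : nexpr) : nat :=
  match x with
  | NConst _ => 1
  | NGet _ i => (ncost i).+1
  | NAdd x y | NSub x y => (ncost x + ncost y).+1
  end.

Fixpoint rcost (x : rexpr) : nat :=
  match x with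
  | RConst _ => 1
  | RGet _ i => (ncost i).+1
  | RAdd x y | RSub x y | RMul x y | RDiv x y => (rcost x + rcost y).+1
  | RExp x => (rcost x).+1
  end.

Fixpoint bcost (b : bexpr) : nat :=
  match b with
  | BNle x y => (ncost x + ncost y).+1
  | BRle x y => (rcost x + rcost y).+1
  | BNot b => (bcost b).+1
  | BAnd b c => (bcost b + bcost c).+1
  end.

(* [exec c s t s'] : started in state s, c halts in state s' after t steps. *)
Inductive exec : program -> state -> nat -> state -> Prop :=
  | ExecSkip s : exec Skip s 1 s
  | ExecNSet a i x s :
      exec (NSet a i x) s (ncost i + ncost x).+1
        (State (upd (nmem s) a (neval s i) (neval s x)) (rmem s))
  | ExecRSet a i x s :
      exec (RSet a i x) s (ncost i + rcost x).+1
        (State (nmem s) (upd (rmem s) a (neval s i) (reval s x)))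
  | ExecSeq c1 c2 s s1 s2 t1 t2 :
      exec c1 s t1 s1 -> exec c2 s1 t2 s2 -> exec (Seq c1 c2) s (t1 + t2) s2
  | ExecIfTrue b c1 c2 s s' t :
      beval s b -> exec c1 s t s' -> exec (If b c1 c2) s (bcost b + t).+1 s'
  | ExecIfFalse b c1 c2 s s' t :
      ~~ beval s b -> exec c2 s t s' -> exec (If b c1 c2) s (bcost b + t).+1 s'
  | ExecWhileTrue b c s s1 s2 t1 t2 :
      beval s b -> exec c s t1 s1 -> exec (While b c) s1 t2 s2 ->
      exec (While b c) s (bcost b + t1 + t2).+1 s2
  | ExecWhileFalse b c s :
      ~~ beval s b -> exec (While b c) s (bcost b).+1 s.

Lemma exec_deterministic c s t1 s1 t2 s2 :
  exec c s t1 s1 -> exec c s t2 s2 -> t1 = t2 /\ s1 = s2.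
Proof.
move=> H; elim: H t2 s2 => {c s t1 s1}; intros;
  match goal with h : exec _ _ ?t ?s' |- _ = ?t /\ _ = ?s' => inversion h end;
  subst;
  repeat match goal with
  | h : is_true (beval ?s ?b), h' : is_true (~~ beval ?s ?b) |- _ =>
      by rewrite h in h'
  | IH : forall t s', exec ?c ?s t s' -> _, h : exec ?c ?s _ _ |- _ =>
      case: (IH _ _ h) => ? ?; subst; clear IH
  end; by [].
Qed.

End Semantics.

(** * Input and output format *)

Section InputOutput.
Variables (R : realType) (V : finType) (adj : rel V).

(* Each edge {u, v} is listed in both directions, as in adjacency lists. *)
Definition arcs : seq (V * V) := [seq a <- enum {: V * V} | adj a.1 a.2].

(* Vertices are numbered by [enum_rank]; i ranges over 0, ..., |V| - 1 and k over
   0, ..., 2|E| - 1.  Cells not listed below contain 0.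
     natural array 0 : |V|, 2|E|
     natural array 1 : k |-> source of the k-th arc
     natural array 2 : k |-> target of the k-th arc
     natural array 3 : i |-> T (vertex i)
     natural array 4 : i |-> 1 if vertex i belongs to S, 0 otherwise
     real array 0    : k |-> eps (k-th arc)
     real array 1    : i |-> p (vertex i) if vertex i belongs to S, 0 otherwise
   No value of eps outside E and no value of p outside S is stored. *)
Definition input_state (eps : V -> V -> R) (T : V -> nat) (S : {set V})
    (p : V -> R) : state R :=
  State
    (fun a i => nth 0 (nth [::]
       [:: [:: #|V|; size arcs];
           [seq enum_rank a.1 : nat | a <- arcs];
           [seq enum_rank a.2 : nat | a <- arcs];
           [seq T v | v <- enum V];
           [seq (v \in S) : nat | v <- enum V]] a) i)
    (fun a i => nth 0%R (nth [::]
       [:: [seq eps a.1 a.2 | a <- arcs];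
           [seq (if v \in S then p v else 0%R) | v <- enum V]] a) i).

(* [NoExtension] is the output "no eps-DP extension of p exists". *)
Inductive output : Type :=
  | NoExtension
  | Extension of (V -> R).

(* The verdict is cell 0 of natural array 5; the values of the extension are in
   real array 2. *)
Definition output_of (s : state R) : output :=
  if nmem s 5 0 == 0 then NoExtension
  else Extension (fun v => rmem s 2 (enum_rank v)).

End InputOutput.

Arguments NoExtension {R V}.

(* Main.v *)
Require Import Defs.
From mathcomp Require Import all_boot all_order all_algebra.
From mathcomp Require Import reals sequences exp.
From mathcomp Require Import zify.

Set Implicit Arguments.
Unset Strict Implicit.
Unset Printing Implicit Defensive.

Import Order.TTheory GRing.Theory Num.Theory.

(** Replacing q(v) by 1 - q(v) where T(v) = 2 turns <=_T into the pointwise order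
    and, at every vertex outside S, all neighbours have the same query value, so
    the privacy constraints become upper bounds Y(u) <= f_uw(Y(w)) with f_uw
    nondecreasing and f_uw(x) >= x on [0, 1].  The largest solution that agrees
    with p on S is computed by relaxing these bounds from the initial value 1, as
    in the Bellman-Ford algorithm.  Since f_uw(x) >= x, the n-th smallest value is
    final after n rounds, as in Dijkstra's algorithm, and |V| rounds suffice.
    The result dominates every private extension, so one exists if and only if
    the result is itself private, which is checked arc by arc. *)

(** * Bellman-Ford relaxation for bounds that are nondecreasing, and inflationary on [0, 1] *)

Section Relaxation.
Local Open Scope ring_scope.
Variables (R : realDomainType) (V : finType) (S : {set V}).
Variables (f : V * V -> R -> R) (A : seq (V * V)).
Implicit Types (Y Z : V -> R) (a : V * V) (s : seq (V * V)).

Definition relax Y a : V -> R := fun v =>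
  if (v == a.1) && (v \notin S) then Num.min (Y v) (f a (Y a.2)) else Y v.

Definition relax_round Y : V -> R := foldl relax Y A.

Lemma relax_le Y a v : relax Y a v <= Y v.
Proof. by rewrite /relax; case: ifP => // _; rewrite ge_min lexx. Qed.

Lemma foldl_relax_le s Y v : foldl relax Y s v <= Y v.
Proof.
elim: s Y => //= a s IH Y; exact: le_trans (IH _) (relax_le _ _ _).
Qed.

Lemma foldl_relax_in s Y v : v \in S -> foldl relax Y s v = Y v.
Proof.
by move=> vS; elim: s Y => //= a s IH Y; rewrite IH /relax vS andbF.
Qed.

Lemma iter_round_in n Y v : v \in S -> iter n relax_round Y v = Y v.
Proof.
by move=> vS; elim: n => //= n IH; rewrite /relax_round foldl_relax_in.
Qed.

Hypothesis f_mono : {in A, forall a, {homo f a : x y / x <= y}}.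
Hypothesis f_ge : {in A, forall a (x : R), 0 <= x <= 1 -> x <= f a x}.

Lemma foldl_relax_unit s Y : {subset s <= A} ->
  (forall v, 0 <= Y v <= 1) -> forall v, 0 <= foldl relax Y s v <= 1.
Proof.
elim: s Y => //= a s IH Y sA Y01; apply: IH.
  by move=> b bs; apply: sA; rewrite inE bs orbT.
have aA : a \in A by apply: sA; rewrite mem_head.
move=> v; rewrite (le_trans (relax_le _ _ _)) ?andbT; last by case/andP: (Y01 v).
rewrite /relax; case: ifP => _; last by case/andP: (Y01 v).
have /andP[Yv _] := Y01 v; have /andP[Yw _] := Y01 a.2.
by rewrite le_min Yv (le_trans Yw) ?f_ge.
Qed.

Lemma iter_round_unit n Y :
  (forall v, 0 <= Y v <= 1) -> forall v, 0 <= iter n relax_round Y v <= 1.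
Proof. by move=> Y01; elim: n => //= n IH; apply: foldl_relax_unit. Qed.

Definition subsolution Z : Prop :=
  {in A, forall a, a.1 \notin S -> Z a.1 <= f a (Z a.2)}.

(** Monotonicity gives [Z a.1 <= f a (Z a.2) <= f a (Y a.2)] when [a.1] is outside [S], so no
    relaxation pushes [Y] below [Z]. *)
Lemma subsolution_foldl_relax s Y Z : {subset s <= A} -> subsolution Z ->
  (forall v, Z v <= Y v) -> forall v, Z v <= foldl relax Y s v.
Proof.
move=> + solZ; elim: s Y => //= a s IH Y sA ZY; apply: IH.
  by move=> b bs; apply: sA; rewrite inE bs orbT.
have aA : a \in A by apply: sA; rewrite mem_head.
move=> v; rewrite /relax; case: ifP => // /andP[/eqP-> aS].
by rewrite le_min ZY (le_trans (solZ a aA aS)) ?f_mono.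
Qed.

Lemma subsolution_iter_round n Y Z : subsolution Z ->
  (forall v, Z v <= Y v) -> forall v, Z v <= iter n relax_round Y v.
Proof.
by move=> solZ ZY; elim: n => //= n IH; apply: subsolution_foldl_relax.
Qed.

(* The invariant of Dijkstra's algorithm for the set F of visited vertices. *)
Definition settled Y (F : {set V}) : Prop :=
  {in F & ~: F, forall u w, Y u <= Y w} /\
  {in A, forall a, a.1 \notin S -> a.2 \in F -> Y a.1 <= f a (Y a.2)}.

(** [Y x] is the least value outside [F]. Since [f a] is inflationary, an arc with target outside
    [F] offers at least [Y x], and arcs into [F] are already satisfied. Hence the values on [x |: F]
    stay fixed, and every arc into [x] is relaxed against the final value [Y x]. *)
Lemma round_settled Y (F : {set V}) x : (forall v, 0 <= Y v <= 1) ->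
  settled Y F -> x \notin F -> {in ~: F, forall w, Y x <= Y w} ->
  settled (relax_round Y) (x |: F).
Proof.
move=> Y01 [FY closed] xF xmin.
have YFx : {in F, forall u, Y u <= Y x} by move=> u uF; apply: FY; rewrite ?inE.
(* Invariant in the middle of a round, after any prefix of the arcs. *)
pose J Y' := {in x |: F, Y' =1 Y} /\ {in ~: F, forall w, Y x <= Y' w}.
have f_geJ Y' a : a \in A -> a.2 \notin F -> J Y' -> (forall v, Y' v <= Y v) ->
    Y x <= f a (Y' a.2).
  move=> aA a2F [_ J2] Y'Y.
  have Jw : Y x <= Y' a.2 by apply: J2; rewrite inE.
  apply: (le_trans Jw); apply: f_ge => //.
  have /andP[Yx0 _] := Y01 x; have /andP[_ Yw1] := Y01 a.2.
  by rewrite (le_trans Yx0 Jw) (le_trans (Y'Y _) Yw1).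
have Jfoldl s : {subset s <= A} -> J (foldl relax Y s) /\
    {in s, forall a, a.1 \notin S -> a.2 = x ->
       foldl relax Y s a.1 <= f a (Y x)}.
  elim/last_ind: s => [|s a IH] sA.
    by split=> //; split=> // w; apply: xmin.
  have aA : a \in A by apply: sA; rewrite mem_rcons mem_head.
  have [|J12 Jx] := IH.
    by move=> b bs; apply: sA; rewrite mem_rcons inE bs orbT.
  rewrite foldl_rcons; set Y' := foldl relax Y s in J12 Jx *.
  have Y'Y v : Y' v <= Y v by apply: foldl_relax_le.
  have [J1 J2] := J12; split; first split.
  - move=> u uxF; rewrite /relax; case: ifP => [/andP[/eqP ua uS]|_]; last exact: J1.
    (* It remains to see that the new bound does not undercut [Y u]: it is a constraint already
       satisfied if [a.2] is in [F], and at least [Y x >= Y u] otherwise. *)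
    apply/eqP; rewrite J1// eq_le ge_min lexx/= le_min lexx/=.
    have [a2F|a2F] := boolP (a.2 \in F).
      by rewrite J1 ?in_setU1 ?a2F ?orbT// ua closed// -ua.
    apply: le_trans (f_geJ _ _ aA a2F J12 Y'Y).
    by move: uxF; rewrite in_setU1 => /orP[/eqP->|/YFx].
  - move=> w wF; rewrite /relax; case: ifP => [/andP[/eqP wa wS]|_]; last exact: J2.
    rewrite le_min J2//=.
    have [a2F|a2F] := boolP (a.2 \in F); last exact: f_geJ.
    rewrite J1 ?in_setU1 ?a2F ?orbT//.
    apply: le_trans (xmin _ wF) _; rewrite wa closed// -wa//.
  - move=> b; rewrite mem_rcons inE => /orP[/eqP->|bs] bS bx; last first.
      exact: le_trans (relax_le _ _ _) (Jx b bs bS bx).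
    by rewrite /relax eqxx bS/= bx (J1 x) ?setU11// ge_min lexx orbT.
have [//|[J1 J2] Jx] := Jfoldl A.
rewrite -/(relax_round Y) in J1 J2 Jx; split.
  move=> u w uxF; rewrite in_setC in_setU1 negb_or => /andP[_ wF].
  apply: (@le_trans _ _ (Y x)); last by apply: J2; rewrite inE.
  by rewrite J1//; move: uxF; rewrite in_setU1 => /orP[/eqP->|/YFx].
move=> a aA aS; rewrite in_setU1 => /orP[/eqP ax|aF].
  by rewrite ax (J1 x) ?setU11// Jx.
rewrite (J1 a.2) ?in_setU1 ?aF ?orbT//.
exact: le_trans (foldl_relax_le _ _ _) (closed a aA aS aF).
Qed.

(** Each round adds a minimal unsettled vertex to [F], so after [#|V|] rounds [F] is everything and
    the second clause of [settled] covers all arcs with source outside [S]. *)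
Lemma iter_round_subsolution Y : (forall v, 0 <= Y v <= 1) ->
  subsolution (iter #|V| relax_round Y).
Proof.
move=> Y01; pose Yn n := iter n relax_round Y.
suff [F FV [_ closed]] : exists2 F : {set V}, (#|V| <= #|F|)%N & settled (Yn #|V|) F.
  move=> a aA aS; apply: closed => //.
  suff -> : F = [set: V] by rewrite inE.
  by apply/eqP; rewrite eqEcard subsetT cardsT.
suff step n : (n <= #|V|)%N -> exists2 F : {set V}, (n <= #|F|)%N & settled (Yn n) F.
  exact: step.
elim: n => [|n IH] nV.
  by exists set0 => //; split=> [u w|a _ _]; rewrite inE.
have [F nF sF] := IH (ltnW nV).
(* [#|F|] is only bounded from below, so [F] may already be all of [V]; the current values then form
   a subsolution, which a round leaves unchanged. *)
have [FV|] := eqVneq F [set: V].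
  exists F; first by rewrite FV cardsT.
  split=> [u w|a aA aS aF]; first by rewrite FV !inE.
  have [_ /(_ _ _ _) closed] := sF.
  have YnE v : Yn n.+1 v = Yn n v.
    apply/eqP; rewrite eq_le foldl_relax_le /=.
    apply: subsolution_foldl_relax => // b bA bS.
    by apply: closed => //; rewrite FV inE.
  by rewrite !YnE; apply: closed.
rewrite -subTset => /subsetPn[y _ yF].
have [x xF xmin] := @arg_minP _ _ V y (fun v => v \notin F) (Yn n) yF.
exists (x |: F); first by rewrite cardsU1 xF.
apply: round_settled => //; first exact: iter_round_unit.
by move=> w; rewrite inE; apply: xmin.
Qed.

End Relaxation.

(** * Privacy constraints as upper bounds, and the optimal extension *)

Section Optimal.
Local Open Scope ring_scope.
Variable R : realType.

(* The largest x allowed by [x <= e * y] and [1 - y <= e * (1 - x)]. *)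
Definition dp_bound (e y : R) : R := Num.min (e * y) (1 - (1 - y) / e).

Lemma le_dp_bound (e x y : R) : 0 < e ->
  (x <= dp_bound e y) = (x <= e * y) && (1 - y <= e * (1 - x)).
Proof.
move=> e0; rewrite /dp_bound le_min; congr (_ && _).
by rewrite lerBrDr -lerBrDl ler_pdivrMr// mulrC.
Qed.

(** Complementing both values exchanges the two inequalities behind [dp_bound] and reverses the
    direction of the edge. *)
Lemma le_dp_boundC (e x y : R) : 0 < e ->
  (1 - y <= dp_bound e (1 - x)) = (x <= dp_bound e y).
Proof. by move=> e0; rewrite !le_dp_bound// !subKr andbC. Qed.

Lemma dp_bound_homo (e : R) : 0 < e -> {homo dp_bound e : x y / x <= y}.
Proof.
move=> e0 x y xy; rewrite le_dp_bound//; apply/andP.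
(* Through [le_dp_bound], reflexivity yields the two inequalities satisfied by the value
   [dp_bound e x]. *)
have : dp_bound e x <= dp_bound e x by [].
rewrite le_dp_bound// => /andP[h1 h2]; split.
  by rewrite (le_trans h1)// ler_pM2l.
by rewrite (le_trans _ h2)// lerB.
Qed.

Lemma dp_bound_ge (e x : R) : 1 <= e -> 0 <= x <= 1 -> x <= dp_bound e x.
Proof.
move=> e1 /andP[x0 x1]; rewrite le_dp_bound; last exact: lt_le_trans e1.
by rewrite !ler_peMl ?subr_ge0.
Qed.

Variables (V : finType) (adj : rel V) (eps : V -> V -> R).
Variables (T : V -> nat) (S : {set V}) (p : V -> R).
Hypotheses (simple_adj : simple_graph adj) (eps_privacy : privacy_function adj eps).
Hypotheses (T_binary : binary_query T) (boundaryS : boundary adj T \subset S).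
Hypothesis p_unit : unit_valued S p.

Let adj_sym : symmetric adj := proj1 simple_adj.

Lemma mem_arcs a : (a \in arcs adj) = adj a.1 a.2.
Proof. by rewrite mem_filter mem_enum andbT. Qed.

Lemma expR_eps_ge1 u v : adj u v -> 1 <= expR (eps u v).
Proof. by move=> /eps_privacy[? _]; rewrite -expR0 ler_expR. Qed.

Definition arc_bound (a : V * V) : R -> R := dp_bound (expR (eps a.1 a.2)).

(** [arcs] lists each edge in both directions, and each direction accounts for two of the four
    inequalities. *)
Lemma hetero_dpP q : hetero_dp adj eps q <->
  {in arcs adj, forall a, q a.1 <= arc_bound a (q a.2)}.
Proof.
split=> [dp a|dp u v uv].
  rewrite mem_arcs => uv; have [] := dp _ _ uv.
  by rewrite /arc_bound le_dp_bound ?expR_gt0// => -> _ _ ->.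
have vu : adj v u by rewrite adj_sym.
have [_ epsE] := eps_privacy uv.
have := dp (u, v); have := dp (v, u).
rewrite !mem_arcs /arc_bound /= -epsE !le_dp_bound ?expR_gt0//.
by move=> /(_ vu)/andP[-> ->] /(_ uv)/andP[-> ->].
Qed.

(** For a binary query the test means [T v = 1]; in this form it is the comparison that the program
    executes. *)
Definition orient (q : V -> R) : V -> R := fun v =>
  if (T v <= 1)%N then q v else 1 - q v.

Lemma eq_orient q q' v : q v = q' v -> orient q v = orient q' v.
Proof. by rewrite /orient => ->. Qed.

Lemma orientK q : orient (orient q) =1 q.
Proof. by move=> v; rewrite /orient; case: (T v <= 1)%N; rewrite ?subKr. Qed.

Lemma orient_unit q v : (0 <= orient q v <= 1) = (0 <= q v <= 1).
Proof.
by rewrite /orient; case: ifP => // _; rewrite subr_ge0 gerBl andbC.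
Qed.

Lemma le_query_orient q q' :
  le_query T q q' <-> forall v, orient q v <= orient q' v.
Proof.
split=> le v; have := le v; rewrite /orient.
  by move: (T_binary v); rewrite !inE => /orP[]/eqP-> [h1 h2]; auto.
by move=> h; split=> Tv; rewrite Tv in h.
Qed.

(** Two different query values on an edge put [u] in the boundary, hence in [S]. *)
Lemma query_eq u w : adj u w -> u \notin S -> T u = T w.
Proof.
move=> uw; apply: contraNeq => Tuw; apply: (subsetP boundaryS).
rewrite inE; apply/existsP; exists w; rewrite eq_sym Tuw andbT !inE.
apply/andP; split; first by apply: contraNneq Tuw => ->.
by apply/existsP; exists u; rewrite inE eqxx.
Qed.

(** Where the query is 2, complementing turns the bound for [(u, w)] into the one for [(w, u)],
    which privacy also provides. *)
Lemma le_orient_arc q u w : adj u w -> T u = T w -> hetero_dp adj eps q ->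
  orient q u <= arc_bound (u, w) (orient q w).
Proof.
move=> uw Tuw /hetero_dpP dp; rewrite /orient -Tuw; case: ifP => _.
  by apply: (dp (u, w)); rewrite mem_arcs.
have [_ epsE] := eps_privacy uw.
rewrite /arc_bound/= le_dp_boundC ?expR_gt0// epsE.
by apply: (dp (w, u)); rewrite mem_arcs adj_sym.
Qed.

(** Orientation keeps or complements both ends of an edge with equal queries, so there the oriented
    bounds express privacy. On the other edges it would complement one end only, and the raw values
    are compared instead. *)
Lemma hetero_dp_orient q :
  {in arcs adj, forall a, T a.1 = T a.2 ->
     orient q a.1 <= arc_bound a (orient q a.2)} ->
  {in arcs adj, forall a, T a.1 != T a.2 -> q a.1 <= arc_bound a (q a.2)} ->
  hetero_dp adj eps q.
Proof.
move=> dp_eq dp_ne; apply/hetero_dpP => -[u w] uw.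
have [Tuw|] := eqVneq (T u) (T w); last exact: (dp_ne (u, w) uw).
rewrite mem_arcs in uw.
have := dp_eq (u, w); have := dp_eq (w, u).
rewrite !mem_arcs/= adj_sym uw => /(_ isT (esym Tuw)) + /(_ isT Tuw).
rewrite /orient -Tuw; case: ifP => // _ + _.
have [_ epsE] := eps_privacy uw.
by rewrite /arc_bound/= le_dp_boundC ?expR_gt0// epsE.
Qed.

Definition bf_init : V -> R := fun v => if v \in S then orient p v else 1.

Definition bf_values : V -> R :=
  iter #|V| (relax_round S arc_bound (arcs adj)) bf_init.

Lemma arc_bound_homo : {in arcs adj, forall a, {homo arc_bound a : x y / x <= y}}.
Proof. by move=> a _; apply/dp_bound_homo/expR_gt0. Qed.

Lemma arc_bound_ge :
  {in arcs adj, forall a (x : R), 0 <= x <= 1 -> x <= arc_bound a x}.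
Proof.
by move=> a; rewrite mem_arcs => ha x; apply/dp_bound_ge/expR_eps_ge1.
Qed.

Lemma bf_init_unit v : 0 <= bf_init v <= 1.
Proof.
rewrite /bf_init; case: ifPn => [vS|_]; last by rewrite ler01 lexx.
by rewrite orient_unit p_unit.
Qed.

Lemma bf_values_extension : extension S p (orient bf_values).
Proof.
split=> [v _|v vS].
  rewrite orient_unit; apply: iter_round_unit bf_init_unit _.
  exact: arc_bound_ge.
rewrite -[RHS]orientK /orient /bf_values iter_round_in// /bf_init vS.
by rewrite /orient; case: ifP.
Qed.

(** Outside [S] all neighbours share the query value, so [orient q] is a subsolution below the
    initial values. *)
Lemma orient_le_bf_values q v : dp_extension adj eps S p q ->
  orient q v <= bf_values v.
Proof.
move=> [[q_unit qS] dp]; apply: subsolution_iter_round.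
- exact: arc_bound_homo.
- move=> [u w]; rewrite mem_arcs/= => uw uS.
  exact: le_orient_arc (query_eq uw uS) dp.
move=> {}v; rewrite /bf_init; case: ifPn => [vS|_].
  by rewrite /orient qS.
by have := q_unit v (in_setT v); rewrite -orient_unit => /andP[].
Qed.

(** Arcs with source outside [S] are satisfied after the last round; [q] certifies the others. If
    the queries differ, both ends lie in [S], where the result agrees with [q]. If they agree and
    the source is in [S], the source value is that of [q] and the target value dominates that of
    [q]. *)
Lemma bf_values_hetero_dp q : dp_extension adj eps S p q ->
  hetero_dp adj eps (orient bf_values).
Proof.
move=> qdp; have [[_ qS] dp] := qdp; have [_ bfS] := bf_values_extension.
apply: hetero_dp_orient => -[u w] uw /= Tuw; last first.
  rewrite mem_arcs /= in uw.
  have uS : u \in S by apply: contraNT Tuw => /(query_eq uw)->.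
  have wS : w \in S.
    apply: contraNT Tuw => /(query_eq (u := w) (w := u)).
    by rewrite adj_sym => /(_ uw)->.
  rewrite !bfS// -!qS//; apply: (proj1 (hetero_dpP q)) (u, w) _ => //.
  by rewrite mem_arcs.
rewrite !orientK.
have [uS|uS] := boolP (u \in S); last first.
  exact: iter_round_subsolution arc_bound_homo arc_bound_ge _ bf_init_unit _ uw uS.
have -> : bf_values u = orient q u.
  by rewrite -[LHS]orientK; apply: eq_orient; rewrite bfS// qS.
have uw' := uw; rewrite mem_arcs in uw'.
apply: le_trans (le_orient_arc uw' Tuw dp) _.
exact/(arc_bound_homo uw)/orient_le_bf_values.
Qed.

Lemma bf_values_optimal : hetero_dp adj eps (orient bf_values) ->
  optimal_dp_extension adj eps T S p (orient bf_values).
Proof.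
move=> dp; split=> [|q qdp]; first by split=> //; apply: bf_values_extension.
apply/le_query_orient => v; rewrite orientK; exact: orient_le_bf_values.
Qed.

Lemma optimal_unique q q' : optimal_dp_extension adj eps T S p q ->
  optimal_dp_extension adj eps T S p q' -> q =1 q'.
Proof.
move=> [qdp qmax] [q'dp q'max] v.
have /le_query_orient/(_ v) h1 := qmax _ q'dp.
have /le_query_orient/(_ v) h2 := q'max _ qdp.
rewrite -[LHS]orientK -[RHS]orientK; apply: eq_orient.
by apply/eqP; rewrite eq_le h2.
Qed.

End Optimal.

(** * Total correctness with time bounds on the machine *)

Section Hoare.
Variable R : realType.
Implicit Types (s : state R) (c : program).

Definition triple (K : nat) (P : state R -> Prop) c (Q : state R -> Prop) : Prop :=
  forall s, P s -> exists t s', [/\ exec c s t s', t <= K & Q s'].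

Lemma triple_seq K1 K2 P Q Q' c1 c2 : triple K1 P c1 Q -> triple K2 Q c2 Q' ->
  triple (K1 + K2) P (Seq c1 c2) Q'.
Proof.
move=> h1 h2 s /h1[t1 [s1 [e1 le1]]] /h2[t2 [s2 [e2 le2 Q2]]].
exists (t1 + t2), s2; split=> //; last exact: leq_add.
exact: ExecSeq e1 e2.
Qed.

Fixpoint loop_free c : bool :=
  match c with
  | Seq c1 c2 | If _ c1 c2 => loop_free c1 && loop_free c2
  | While _ _ => false
  | _ => true
  end.

(** The value on [While] is a dummy: [run] is related to [exec] for loop-free programs only. *)
Fixpoint run c s : state R :=
  match c with
  | Skip | While _ _ => s
  | NSet a i x => State (upd (nmem s) a (neval s i) (neval s x)) (rmem s)
  | RSet a i x => State (nmem s) (upd (rmem s) a (neval s i) (reval s x))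
  | Seq c1 c2 => run c2 (run c1 s)
  | If b c1 c2 => if beval s b then run c1 s else run c2 s
  end.

Fixpoint max_cost c : nat :=
  match c with
  | Skip | While _ _ => 1
  | NSet a i x => (ncost i + ncost x).+1
  | RSet a i x => (ncost i + rcost x).+1
  | Seq c1 c2 => max_cost c1 + max_cost c2
  | If b c1 c2 => (bcost b + maxn (max_cost c1) (max_cost c2)).+1
  end.

Lemma exec_run c s : loop_free c ->
  exists2 t, exec c s t (run c s) & t <= max_cost c.
Proof.
elim: c s => //= [|a i x|a i x|c1 IH1 c2 IH2|b c1 IH1 c2 IH2] s.
- by exists 1 => //; apply: ExecSkip.
- by move=> _; eexists; first exact: ExecNSet.
- by move=> _; eexists; first exact: ExecRSet.
- move=> /andP[/IH1-/(_ s)[t1 e1 le1] /IH2-/(_ (run c1 s))[t2 e2 le2]].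
  by exists (t1 + t2); [apply: ExecSeq e1 e2|apply: leq_add].
move=> /andP[/IH1-/(_ s)[t1 e1 le1] /IH2-/(_ s)[t2 e2 le2]].
case: ifPn => sb.
  exists (bcost b + t1).+1; first exact: ExecIfTrue.
  by rewrite ltnS leq_add2l leq_max le1.
exists (bcost b + t2).+1; first exact: ExecIfFalse.
by rewrite ltnS leq_add2l leq_max le2 orbT.
Qed.

Lemma triple_run c (P Q : state R -> Prop) : loop_free c ->
  (forall s, P s -> Q (run c s)) -> triple (max_cost c) P c Q.
Proof.
by move=> lf PQ s /PQ; have [t et le] := exec_run s lf; exists t, (run c s).
Qed.

(* The loop counters are the cells of natural array 6; the bound is cell j of
   natural array 0. *)
Definition counter (x : nat) : nexpr := NGet 6 (NConst x).

Definition for_loop (x j : nat) (c : program) : program :=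
  Seq (NSet 6 (NConst x) (NConst 0))
    (While (BNot (BNle (NGet 0 (NConst j)) (counter x)))
      (Seq c (NSet 6 (NConst x) (NAdd (counter x) (NConst 1))))).

Definition set_counter s x k := State (upd (nmem s) 6 x k) (rmem s).

(** A pass adds 13 to the cost of the body: 6 for the guard, 6 for the increment, 1 for [While]. The
    10 is 3 for the initialisation plus 7 for the failing test. The bound is read again at each
    test, so the invariant has to preserve it. *)
Lemma triple_for K N x j c (I : nat -> state R -> Prop) :
  (forall k s, I k s -> nmem s 0 j = N) ->
  (forall k s l, I k s -> I k (set_counter s x l)) ->
  (forall k, k < N -> triple K (fun s => I k s /\ nmem s 6 x = k) c
    (fun s => I k.+1 s /\ nmem s 6 x = k)) ->
  triple (N * (K + 13) + 10) (I 0) (for_loop x j c) (I N).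
Proof.
move=> IN Iset Ibody s I0.
(* Induction on the number [d] of passes left. *)
suff loop d k s' : d + k = N -> I k s' -> nmem s' 6 x = k ->
    exists t s2, [/\ exec (While (BNot (BNle (NGet 0 (NConst j)) (counter x)))
      (Seq c (NSet 6 (NConst x) (NAdd (counter x) (NConst 1))))) s' t s2,
      t <= d * (K + 13) + 7 & I N s2].
  have [||t [s2 [e2 le2 I2]]] := loop N 0 (set_counter s x 0) (addn0 N).
  - exact: Iset.
  - by rewrite /= /upd !eqxx.
  exists (3 + t), s2; split=> //; last by lia.
  by apply: ExecSeq e2; exact: ExecNSet.
elim: d k s' => [|d IH] k s' dk Ik xk.
  exists 7, s'; split=> //; last by rewrite -dk.
  apply: (@ExecWhileFalse _ (BNot _)); rewrite /= (IN _ _ Ik) xk -dk.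
  by rewrite add0n leqnn.
have kN : k < N by rewrite -dk addSn ltnS leq_addl.
have [t1 [s1 [e1 le1 [I1 x1]]]] := Ibody k kN s' (conj Ik xk).
have [|||t2 [s2 [e2 le2 I2]]] := IH k.+1 (set_counter s1 x (nmem s1 6 x + 1)).
- by rewrite addnS -addSn.
- exact: Iset.
- by rewrite /= /upd !eqxx x1 addn1.
exists (6 + (t1 + 6) + t2).+1, s2; split=> //; last by lia.
apply: (@ExecWhileTrue _ (BNot _)) e2.
  by rewrite /= (IN _ _ Ik) xk -ltnNge.
by apply: ExecSeq e1 _; exact: ExecNSet.
Qed.

End Hoare.

(** * The Bellman-Ford program *)

Definition vert : nexpr := counter 0.
Definition src : nexpr := NGet 1 (counter 0).
Definition tgt : nexpr := NGet 2 (counter 0).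
Definition arc_exp : rexpr := RExp (RGet 0 (counter 0)).
Definition val (i : nexpr) : rexpr := RGet 2 i.
Definition compl (x : rexpr) : rexpr := RSub (RConst 1) x.

Definition init_body : program :=
  If (BNle (NConst 1) (NGet 4 vert))
    (If (BNle (NGet 3 vert) (NConst 1))
      (RSet 2 vert (RGet 1 vert))
      (RSet 2 vert (compl (RGet 1 vert))))
    (RSet 2 vert (RConst 1)).

Definition decrease (x : rexpr) : program :=
  If (BRle (val src) x) Skip (RSet 2 src x).

(** Expressions have no minimum, so the smaller of the two terms of [dp_bound] is selected by a
    test. *)
Definition relax_body : program :=
  let x1 := RMul arc_exp (val tgt) in
  let x2 := compl (RDiv (compl (val tgt)) arc_exp) in
  If (BNle (NConst 1) (NGet 4 src)) Skip
    (If (BRle x1 x2) (decrease x1) (decrease x2)).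

Definition orient_body : program :=
  If (BNle (NGet 3 vert) (NConst 1)) Skip (RSet 2 vert (compl (val vert))).

Definition check_body : program :=
  If (BAnd (BRle (val src) (RMul arc_exp (val tgt)))
           (BRle (compl (val tgt)) (RMul arc_exp (compl (val src)))))
    Skip (NSet 5 (NConst 0) (NConst 0)).

(** The verdict starts at 1 and only the final check can reset it to 0. Rounds use counter 1 because
    the pass nested in them uses counter 0. *)
Definition bellman_ford : program :=
  Seq (NSet 5 (NConst 0) (NConst 1))
  (Seq (for_loop 0 0 init_body)
  (Seq (for_loop 1 0 (for_loop 0 1 relax_body))
  (Seq (for_loop 0 0 orient_body)
       (for_loop 0 1 check_body)))).

(** * Correctness of the program *)

Section Correctness.
Variables (R : realType) (V : finType) (adj : rel V) (eps : V -> V -> R).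
Variables (T : V -> nat) (S : {set V}) (p : V -> R).

Let s0 := input_state adj eps T S p.
Let n := #|V|.
Let m := size (arcs adj).

(* Array 6 is left out, as it holds the loop counters. *)
Definition holds (s : state R) (Y : V -> R) (ok : bool) : Prop :=
  [/\ forall a i, a < 5 -> nmem s a i = nmem s0 a i,
      forall a i, a < 2 -> rmem s a i = rmem s0 a i,
      forall v, rmem s 2 (enum_rank v) = Y v & nmem s 5 0 = ok].

Lemma enum_rank_inj_nat (u v : V) : (enum_rank u == enum_rank v :> nat) = (u == v).
Proof. by rewrite (inj_eq val_inj) (inj_eq enum_rank_inj). Qed.

Lemma nth_enum_map X (x0 : X) (g : V -> X) v :
  nth x0 [seq g v | v <- enum V] (enum_rank v) = g v.
Proof. by rewrite (nth_map v) ?nth_enum_rank// -cardE ltn_ord. Qed.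

Lemma input_query v : nmem s0 3 (enum_rank v) = T v.
Proof. exact: nth_enum_map. Qed.

Lemma input_mem v : nmem s0 4 (enum_rank v) = (v \in S).
Proof. exact: (nth_enum_map _ (fun v => (v \in S) : nat)). Qed.

Lemma input_value v : rmem s0 1 (enum_rank v) = if v \in S then p v else 0%R.
Proof. exact: nth_enum_map. Qed.

Lemma input_src k a : k < m -> nmem s0 1 k = enum_rank (nth a (arcs adj) k).1.
Proof. by move=> km; rewrite /= (nth_map a). Qed.

Lemma input_tgt k a : k < m -> nmem s0 2 k = enum_rank (nth a (arcs adj) k).2.
Proof. by move=> km; rewrite /= (nth_map a). Qed.

Lemma input_eps k a : k < m ->
  rmem s0 0 k = eps (nth a (arcs adj) k).1 (nth a (arcs adj) k).2.
Proof. by move=> km; rewrite /= (nth_map a). Qed.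

(** [V] may be empty, so a default for [nth] is taken from the arc list, which [k < m] makes
    nonempty. *)
Lemma arc_default k : k < m -> V * V.
Proof. by rewrite /m; case: (arcs adj) => // a. Qed.

Lemma holds_sizes s Y ok : holds s Y ok -> nmem s 0 0 = n /\ nmem s 0 1 = m.
Proof. by move=> [h _ _ _]; rewrite !h. Qed.

Lemma holds_eq s Y Y' ok : Y =1 Y' -> holds s Y ok -> holds s Y' ok.
Proof. by move=> YY' [h1 h2 h3 h4]; split=> // v; rewrite h3 YY'. Qed.

Lemma holds_counter s Y ok x l : holds s Y ok -> holds (set_counter s x l) Y ok.
Proof.
move=> [h1 h2 h3 h4]; split=> //= a i a5.
by rewrite /upd; case: eqP a5 => [->|_]//= a5; apply: h1.
Qed.

Lemma holds_RSet s Y ok u x : holds s Y ok ->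
  holds (State (nmem s) (upd (rmem s) 2 (enum_rank u) x))
    (fun v => if v == u then x else Y v) ok.
Proof.
move=> [h1 h2 h3 h4]; split=> //= [a i a2|v].
  by rewrite /upd; case: eqP a2 => [->|_]//= a2; apply: h2.
by rewrite /upd eqxx/= enum_rank_inj_nat h3.
Qed.

(** Invariant: vertices of rank below [k] carry [g], the others still [Y]. The body at [u] can thus
    rely on the old value at [u]. *)
Lemma triple_vertices body (Y g : V -> R) ok : loop_free body ->
  (forall s Y' u, holds s Y' ok -> nmem s 6 0 = enum_rank u -> Y' u = Y u ->
     holds (run body s) (fun v => if v == u then g u else Y' v) ok /\
     nmem (run body s) 6 0 = nmem s 6 0) ->
  triple (n * (max_cost body + 13) + 10)
    (fun s => holds s Y ok) (for_loop 0 0 body) (fun s => holds s g ok).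
Proof.
move=> lf body_step.
pose I k s := holds s (fun v => if enum_rank v < k then g v else Y v) ok.
have forI : triple (n * (max_cost body + 13) + 10) (I 0) (for_loop 0 0 body) (I n).
  apply: (triple_for (I := I)) => [k s /holds_sizes[]//|k s l|k kn].
    exact: holds_counter.
  apply: triple_run => // s [hs xk].
  pose u := enum_val (Ordinal kn).
  have uk : enum_rank u = k :> nat by rewrite enum_valK.
  have [||h1 h2] := body_step _ _ u hs; [by rewrite xk uk|by rewrite uk ltnn|].
  rewrite h2; split=> //; apply: holds_eq h1 => v /=.
  rewrite [in RHS]ltnS [in RHS]leq_eqVlt -uk enum_rank_inj_nat.
  by have [->|] := eqVneq v u.
move=> s hs; have [t [s' [e le hs']]] := forI s hs.
by exists t, s'; split=> //; apply: holds_eq hs' => v; rewrite ltn_ord.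
Qed.

(** A pass over the arcs is a left fold whose accumulator [X] is the vector of values when relaxing
    and the verdict when checking. [C] carries facts about an enclosing loop. *)
Lemma triple_arcs body (X : Type) (step : X -> V * V -> X)
    (Y : X -> V -> R) (ok : X -> bool) (C : state R -> Prop) :
  loop_free body ->
  (forall s l, C s -> C (set_counter s 0 l)) ->
  (forall s x k a0, k < m -> let a := nth a0 (arcs adj) k in
     C s -> holds s (Y x) (ok x) -> nmem s 6 0 = k ->
     [/\ C (run body s), holds (run body s) (Y (step x a)) (ok (step x a)) &
         nmem (run body s) 6 0 = nmem s 6 0]) ->
  forall x, triple (m * (max_cost body + 13) + 10)
    (fun s => C s /\ holds s (Y x) (ok x)) (for_loop 0 1 body)
    (fun s => C s /\ holds s (Y (foldl step x (arcs adj))) (ok (foldl step x (arcs adj)))).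
Proof.
move=> lf Cset body_step x.
pose x_ k := foldl step x (take k (arcs adj)).
have -> : foldl step x (arcs adj) = x_ m by rewrite /x_ take_size.
have x0 : x_ 0 = x by rewrite /x_ take0.
suff: triple (m * (max_cost body + 13) + 10)
    (fun s => C s /\ holds s (Y (x_ 0)) (ok (x_ 0))) (for_loop 0 1 body)
    (fun s => C s /\ holds s (Y (x_ m)) (ok (x_ m))) by rewrite x0.
apply: (triple_for (I := fun k s => C s /\ holds s (Y (x_ k)) (ok (x_ k)))).
- by move=> k s [_ /holds_sizes[]].
- by move=> k s l [Cs hs]; split; [apply: Cset|apply: holds_counter].
move=> k km; apply: triple_run => // s [[Cs hs] xk].
have a0 := arc_default km.
have [C' h' ->] := body_step s (x_ k) k a0 km Cs hs xk; split=> //; split=> //.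
by rewrite /x_ (take_nth a0 km) foldl_rcons.
Qed.

Lemma triple_init :
  triple (n * (max_cost init_body + 13) + 10)
    (fun s => holds s (fun=> 0%R) true) (for_loop 0 0 init_body)
    (fun s => holds s (bf_init T S p) true).
Proof.
apply: triple_vertices => // s Y u hs xk _.
have [h1 h2 _ _] := hs.
rewrite /= xk !h1// input_mem lt0b input_query h2// input_value /bf_init /orient.
case: (u \in S); last by split=> //; exact: holds_RSet.
by case: ifP => _ /=; split=> //; exact: holds_RSet.
Qed.

Lemma triple_orient Y :
  triple (n * (max_cost orient_body + 13) + 10)
    (fun s => holds s Y true) (for_loop 0 0 orient_body)
    (fun s => holds s (orient T Y) true).
Proof.
apply: triple_vertices => // s Y' u hs xk Yu.
have [h1 _ h3 _] := hs.
rewrite /= xk h1// input_query /orient.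
case: ifP => _; split=> //.
  by apply: holds_eq hs => v; case: eqP => [->|].
by rewrite h3 Yu; exact: holds_RSet.
Qed.

Lemma run_decrease s Y ok x k a0 : let a := nth a0 (arcs adj) k in
  k < m -> holds s Y ok -> nmem s 6 0 = k ->
  holds (run (decrease x) s)
    (fun v => if v == a.1 then Num.min (Y v) (reval s x) else Y v) ok /\
  nmem (run (decrease x) s) = nmem s.
Proof.
move=> a km hs xk; have [h1 _ h3 _] := hs.
rewrite /= xk h1// (input_src a0)// -/a h3.
case: ifP => le; split=> //.
  by apply: holds_eq hs => v; case: eqP => // ->; rewrite (min_idPl le).
apply: holds_eq (holds_RSet a.1 (reval s x) hs) => v; case: eqP => // ->.
by rewrite (min_idPr _)// ltW// ltNge le.
Qed.

(** The counter [r] of the enclosing loop is carried along so that the pass can serve as the body of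
    [for_loop 1 0]. *)
Lemma triple_relax r Y :
  triple (m * (max_cost relax_body + 13) + 10)
    (fun s => nmem s 6 1 = r /\ holds s Y true) (for_loop 0 1 relax_body)
    (fun s => nmem s 6 1 = r /\
       holds s (relax_round S (arc_bound eps) (arcs adj) Y) true).
Proof.
apply: (triple_arcs (Y := id) (ok := fun=> true) (C := fun s => nmem s 6 1 = r)) => //.
move=> s {}Y k a0 km a Cs hs xk; have [h1 h2 h3 _] := hs.
rewrite /relax_body; set x1 := RMul _ _; set x2 := compl _.
have ex1 : reval s x1 = (expR (eps a.1 a.2) * Y a.2)%R.
  by rewrite /= xk (h1 2)// (input_tgt a0)// (h2 0)// (input_eps a0)// h3.
have ex2 : reval s x2 = (1 - (1 - Y a.2) / expR (eps a.1 a.2))%R.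
  by rewrite /= xk (h1 2)// (input_tgt a0)// (h2 0)// (input_eps a0)// h3.
cbn [run beval neval src counter]; rewrite xk (h1 4)// (h1 1)// (input_src a0)// -/a input_mem lt0b.
have [aS|aS] := boolP (a.1 \in S).
  split=> //; apply: holds_eq hs => v; rewrite /relax.
  by case: eqP => // ->; rewrite aS.
have relaxE z : z = arc_bound eps a (Y a.2) ->
    (fun v => if v == a.1 then Num.min (Y v) z else Y v) =1
    relax S (arc_bound eps) Y a.
  by move=> -> v; rewrite /relax; case: eqP => // ->; rewrite aS.
case: ifP => le.
  have [h ->] := run_decrease x1 a0 km hs xk; split=> //.
  apply: holds_eq h; apply: relaxE; rewrite /arc_bound /dp_bound -ex1 -ex2.
  by rewrite (min_idPl le).
have [h ->] := run_decrease x2 a0 km hs xk; split=> //.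
apply: holds_eq h; apply: relaxE; rewrite /arc_bound /dp_bound -ex1 -ex2.
by rewrite (min_idPr _)// ltW// ltNge le.
Qed.

Definition dp_check (q : V -> R) (a : V * V) : bool :=
  (q a.1 <= arc_bound eps a (q a.2))%R.

Lemma triple_check q :
  triple (m * (max_cost check_body + 13) + 10)
    (fun s => holds s q true) (for_loop 0 1 check_body)
    (fun s => holds s q (all (dp_check q) (arcs adj))).
Proof.
(* The verdict as a left fold, the shape required by [triple_arcs]. *)
pose step (b : bool) a := b && dp_check q a.
have -> : all (dp_check q) (arcs adj) = foldl step true (arcs adj).
  by elim/last_ind: (arcs adj) => //= l a IH; rewrite foldl_rcons all_rcons andbC IH.
suff h : triple (m * (max_cost check_body + 13) + 10)
    (fun s => True /\ holds s q true) (for_loop 0 1 check_body)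
    (fun s => True /\ holds s q (foldl step true (arcs adj))).
  move=> s hs; have [t [s' [e le [_ hs']]]] := h s (conj I hs).
  by exists t, s'.
apply: (triple_arcs (Y := fun=> q) (ok := id) (C := fun=> True)) => //.
move=> s b k a0 km a _ hs xk; have [h1 h2 h3 h4] := hs.
have evE : beval s (BAnd (BRle (val src) (RMul arc_exp (val tgt)))
    (BRle (compl (val tgt)) (RMul arc_exp (compl (val src))))) = dp_check q a.
  rewrite /= xk (h1 1)// (h1 2)// (input_src a0)// (input_tgt a0)// (h2 0)//.
  by rewrite (input_eps a0)// !h3 /dp_check /arc_bound le_dp_bound ?expR_gt0.
rewrite /check_body; cbn [run]; rewrite evE /step; case: ifP => _ /=.
  by rewrite andbT.
rewrite andbF; split=> //; split=> //= c i c5.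
by rewrite /upd; case: eqP c5 => [->|_]//= c5; apply: h1.
Qed.

Lemma triple_rounds :
  triple (n * (m * (max_cost relax_body + 13) + 10 + 13) + 10)
    (fun s => holds s (bf_init T S p) true)
    (for_loop 1 0 (for_loop 0 1 relax_body))
    (fun s => holds s (bf_values adj eps T S p) true).
Proof.
apply: (triple_for (I := fun r s => holds s
    (iter r (relax_round S (arc_bound eps) (arcs adj)) (bf_init T S p)) true)).
- by move=> r s /holds_sizes[].
- by move=> r s l; exact: holds_counter.
move=> r _ s [hs xr].
by have [t [s' [e le [x' hs']]]] := triple_relax (conj xr hs); exists t, s'.
Qed.

Definition time_bound : nat :=
  3 + (n * (max_cost init_body + 13) + 10 +
  (n * (m * (max_cost relax_body + 13) + 10 + 13) + 10 +
  (n * (max_cost orient_body + 13) + 10 +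
  (m * (max_cost check_body + 13) + 10)))).

Let q : V -> R := orient T (bf_values adj eps T S p).

Lemma bellman_ford_exec : exists t s,
  [/\ exec bellman_ford s0 t s, t <= time_bound &
      holds s q (all (dp_check q) (arcs adj))].
Proof.
suff h : triple time_bound (fun s => s = s0) bellman_ford
    (fun s => holds s q (all (dp_check q) (arcs adj))) by exact: h.
(* 3 is the cost of setting the verdict to 1. *)
apply: (triple_seq (K1 := 3) _ (triple_seq triple_init (triple_seq triple_rounds
  (triple_seq (@triple_orient _) (@triple_check q))))).
move=> s ->; exists 3; eexists; split=> //; first exact: ExecNSet.
split=> // [a i a5|v].
  by rewrite /= /upd; case: eqP a5 => [->|].
(* Real array 2 is absent from the input, so its cells read 0. *)
by rewrite /= nth_nil.
Qed.

Lemma size_arcs : m <= n * n.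
Proof.
rewrite /m /arcs size_filter (leq_trans (count_size _ _))//.
by rewrite -cardE card_prod.
Qed.

End Correctness.

(** * Cubic time bound, and the final verdict and output *)

Definition time_constant : nat :=
  max_cost init_body + max_cost relax_body + max_cost orient_body +
  max_cost check_body + 100.

(** There are at most [#|V| ^ 2] arcs, each relaxed in [#|V|] rounds, hence the exponent 3. The 100
    in [time_constant] absorbs the loop overheads, 75 in the coefficient of the cube and 43 in the
    additive term. *)
Lemma time_bound_poly (V : finType) (adj : rel V) :
  time_bound adj <= time_constant * (#|V| + #|edges adj|) ^ 3 + time_constant.
Proof.
rewrite /time_bound /time_constant.
move: (max_cost _) (max_cost _) (max_cost _) (max_cost _) => c4 c3 c2 c1.
have := size_arcs adj; move: (size _) => m; set n := #|V| => mn.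
set N := n + _; have nN : n <= N by apply: leq_addr.
have n3 : n * n * n <= N ^ 3 by rewrite expnS expnS expn1 mulnA !leq_mul.
have n1 : n <= N ^ 3 by apply: leq_trans n3; case: (n) => // k; rewrite leq_pmull.
have m1 : m <= N ^ 3.
  by apply: leq_trans n3; case: (n) mn => [|k] // mn; rewrite (leq_trans mn) ?leq_pmulr.
have nm : n * m <= N ^ 3.
  by apply: leq_trans n3; rewrite mulnC leq_mul2r mn orbT.
have := leq_mul nm (leqnn (c2 + 13)).
have := leq_mul n1 (leqnn (c1 + 13 + 23 + c3 + 13)).
have := leq_mul m1 (leqnn (c4 + 13)).
move: (N ^ 3) => x; clear; lia.
Qed.

Theorem theorem1 :
  exists (P : program) (c k : nat),
  forall (R : realType) (V : finType) (adj : rel V) (eps : V -> V -> R)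
    (T : V -> nat) (S : {set V}) (p : V -> R),
  simple_graph adj -> connected_graph adj ->
  privacy_function adj eps ->
  binary_query T ->
  boundary adj T \subset S ->
  unit_valued S p ->
  exists (t : nat) (s : state R),
    [/\ exec P (input_state adj eps T S p) t s,
        t <= c * (#|V| + #|edges adj|) ^ k + c,
        ~ (exists q : V -> R, dp_extension adj eps S p q) ->
          output_of V s = NoExtension
      & (exists q : V -> R, dp_extension adj eps S p q) ->
          exists pt : V -> R,
            [/\ output_of V s = Extension pt,
                optimal_dp_extension adj eps T S p pt
              & forall q : V -> R,
                  optimal_dp_extension adj eps T S p q -> q =1 pt]].
Proof.
exists bellman_ford, time_constant, 3 => R V adj eps T S p sG _ epsP Tbin bS p01.
have [t [s [exs tle [_ _ sq sok]]]] := bellman_ford_exec adj eps T S p.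
set q := orient T _ in sq sok.
have okP : reflect (hetero_dp adj eps q) (all (dp_check eps q) (arcs adj)).
  by apply: (iffP allP) => /(hetero_dpP sG epsP).
exists t, s; split=> //; first exact: leq_trans tle (time_bound_poly adj).
  (* Were the verdict 1, [q] would itself be a private extension. *)
  move=> noext; rewrite /output_of sok; case: okP => // dp; case: noext.
  by exists q; split=> //; apply: bf_values_extension.
move=> [q' q'dp].
have dp : hetero_dp adj eps q by apply: bf_values_hetero_dp q'dp.
(* The output agrees with [q] pointwise, so optimality is carried over value by value. *)
pose pt (v : V) := rmem s 2 (enum_rank v).
have pt_opt : optimal_dp_extension adj eps T S p pt.
  have [[[q01 qS] qdp] qmax] : optimal_dp_extension adj eps T S p q.
    exact: bf_values_optimal.
  split=> [|q2 q2dp v]; last by rewrite /pt sq; apply: qmax.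
  split; first split=> v vS; rewrite /pt ?sq; [exact: q01|exact: qS|].
  by move=> u w uw; rewrite /pt !sq; apply: qdp.
exists pt; split=> //; last by move=> q2 q2_opt; exact: (optimal_unique Tbin q2_opt pt_opt).
by rewrite /output_of sok; case: okP.
Qed.
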